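(* Let $G$ be a group, $R$ a commutative $G$-graded ring with nonzero unity, $M$ a nonzero $G$-graded $R$-module, $K$ and $N$ graded $r$-submodules of $M$, and $P$ a graded ideal of $R$ such that $P\cap(h(R)-Z(M))\neq\emptyset$. If $PK=PN$, then $K=N$.
   Context: A commutative ring $R$ is $G$-graded if $R=\bigoplus_{g\in G}R_g$ with additive subgroups $R_g$ satisfying $R_gR_h\subseteq R_{gh}$; an $R$-module $M$ is $G$-graded if $M=\bigoplus_{g\in G}M_g$ with additive subgroups $M_g$ satisfying $R_gM_h\subseteq M_{gh}$. Put $h(R)=\bigcup_{g\in G}R_g$ and $h(M)=\bigcup_{g\in G}M_g$. An ideal $P$ of $R$ is graded if $P=\bigoplus_{g\in G}(P\cap R_g)$; an $R$-submodule $K$ of $M$ is graded if $K=\bigoplus_{g\in G}(K\cap M_g)$. Notation: $Ann_M(a)=\{m\in M: am=0\}$ for $a\in R$; $Z(M)=\{a\in h(R): Ann_M(a)\neq\{0\}\}$; $h(R)-Z(M)$ is the set difference; $PK$ is the $R$-submodule generated by all products $pk$ with $p\in P$, $k\in K$. A proper graded $R$-submodule $K$ of $M$ is a graded $r$-submodule if whenever $a\in h(R)$ and $x\in h(M)$ satisfy $ax\in K$ and $Ann_M(a)=\{0\}$, then $x\in K$. *)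

(* Defs.v *)
From mathcomp Require Import all_boot all_algebra classical_sets.

Set Implicit Arguments.
Unset Strict Implicit.
Unset Printing Implicit Defensive.

Import GRing.Theory.
Local Open Scope classical_set_scope.
Local Open Scope ring_scope.

Definition homogeneous (G V : Type) (B : G -> set V) : set V :=
  \bigcup_(g in [set: G]) B g.

(* The sums range over duplicate-free finite lists of degrees because [G] may
   be infinite. *)
Definition family_sum (G : groupType) (V : zmodType) (B : G -> set V) : set V :=
  [set x | exists (s : seq G) (f : G -> V),
     [/\ uniq s, forall g, B g (f g) & x = \sum_(g <- s) f g]].

Definition independent_family
    (G : groupType) (V : zmodType) (B : G -> set V) : Prop :=
  forall (s : seq G) (f : G -> V), uniq s -> (forall g, B g (f g)) ->
    \sum_(g <- s) f g = 0 -> forall g, g \in s -> f g = 0.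

Definition internal_direct_sum
    (G : groupType) (V : zmodType) (A : set V) (B : G -> set V) : Prop :=
  A = family_sum B /\ independent_family B.

Definition subgroup (V : zmodType) (A : set V) : Prop :=
  GRing.zmod_closed [in A].

Definition submodule (R : nzRingType) (M : lmodType R) (K : set M) : Prop :=
  GRing.submod_closed [in K].

Record graded_ring (G : groupType) (R : nzRingType) (Rg : G -> set R) : Prop :=
  GradedRing {
    graded_ring_subgroup : forall g, subgroup (Rg g);
    graded_ring_sum : internal_direct_sum [set: R] Rg;
    graded_ring_mul : forall g h a b,
      Rg g a -> Rg h b -> Rg (g * h)%g (a * b) }.

Record graded_module (G : groupType) (R : nzRingType) (M : lmodType R)
    (Rg : G -> set R) (Mg : G -> set M) : Prop :=
  GradedModule {
    graded_module_subgroup : forall g, subgroup (Mg g);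
    graded_module_sum : internal_direct_sum [set: M] Mg;
    graded_module_scale : forall g h a m,
      Rg g a -> Mg h m -> Mg (g * h)%g (a *: m) }.

Definition graded_submodule (G : groupType) (R : nzRingType) (M : lmodType R)
    (Mg : G -> set M) (K : set M) : Prop :=
  submodule K /\ internal_direct_sum K (fun g => K `&` Mg g).

(* Ideals of [R] are the submodules of the regular module [R^o]; the unit
   ideal is allowed, unlike in MathComp's [idealr_closed]. *)
Definition graded_ideal (G : groupType) (R : comNzRingType) (Rg : G -> set R)
    (P : set R) : Prop :=
  @graded_submodule G R R^o Rg P.

Definition Ann (R : nzRingType) (M : lmodType R) (a : R) : set M :=
  [set m | a *: m = 0].
Arguments Ann {R} M a.

Definition zero_divisors (G : groupType) (R : nzRingType) (M : lmodType R)
    (Rg : G -> set R) : set R :=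
  [set a | homogeneous Rg a /\ Ann M a <> [set 0]].
Arguments zero_divisors {G R} M Rg.

Definition ideal_mul (R : nzRingType) (M : lmodType R)
    (P : set R) (K : set M) : set M :=
  smallest (@submodule R M) [set p *: k | p in P & k in K].

Record graded_r_submodule (G : groupType) (R : nzRingType) (M : lmodType R)
    (Rg : G -> set R) (Mg : G -> set M) (K : set M) : Prop :=
  GradedRSubmodule {
    graded_r_submodule_graded : graded_submodule Mg K;
    graded_r_submodule_proper : K <> [set: M];
    graded_r_submodule_mem : forall a x,
      homogeneous Rg a -> homogeneous Mg x ->
      K (a *: x) -> Ann M a = [set 0] -> K x }.

(* Main.v *)
Require Import Defs.
From mathcomp Require Import all_boot all_algebra boolp classical_sets.

Import GRing.Theory.
Local Open Scope classical_set_scope.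
Local Open Scope ring_scope.

(** The hypothesis on [P] provides a homogeneous [a] in [P] that annihilates
    no nonzero element of [M].  If [x] is a homogeneous element of [K], then
    [a *: x] lies in [PK = PN], hence in [N] because [N] absorbs scalars; the
    r-property of [N] cancels [a], so [x] is in [N].  A graded submodule is
    determined by its homogeneous elements ([graded_submodule_subset]), so
    [K] is contained in [N] ([subset_of_ideal_mul_subset]).  The argument is
    symmetric in [K] and [N]. *)

Lemma submodule_sum (R : nzRingType) (M : lmodType R) (K : set M)
    (I : Type) (s : seq I) (f : I -> M) :
  submodule K -> (forall i, K (f i)) -> K (\sum_(i <- s) f i).
Proof.
move=> [K0 Klin] Kf.
apply: big_ind => [|x y Kx Ky|i _]; last exact: Kf.
- by move: K0; rewrite inE.
- by have := Klin 1 x y (mem_set Kx) (mem_set Ky); rewrite scale1r inE.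
Qed.

Lemma submodule_scale (R : nzRingType) (M : lmodType R) (K : set M) a x :
  submodule K -> K x -> K (a *: x).
Proof.
move=> [K0 Klin] Kx.
by have := Klin a x 0 (mem_set Kx) K0; rewrite addr0 inE.
Qed.

(** The homogeneous components of an element of a graded submodule [K] stay in
    [K], so inclusion need only be tested on them. *)
Lemma graded_submodule_subset {G : groupType} {R : nzRingType}
    {M : lmodType R} {Mg : G -> set M} {K N : set M} :
  graded_submodule Mg K -> submodule N ->
  (forall x, K x -> homogeneous Mg x -> N x) -> K `<=` N.
Proof.
move=> [_ [defK _]] subN homN x; rewrite defK => -[s [f [_ Kf ->]]].
apply: submodule_sum => // g.
by have [Kfg Mfg] := Kf g; apply: homN => //; exists g.
Qed.

Lemma ideal_mul_subset {R : nzRingType} {M : lmodType R}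
    {P : set R} {K : set M} :
  submodule K -> ideal_mul P K `<=` K.
Proof.
move=> subK; apply: smallest_sub => // _ [p _ [k Kk <-]].
exact: submodule_scale.
Qed.

(** One homogeneous [a] in [P] that is regular on [M] suffices to cancel [P],
    because the r-property of [N] turns membership of [a *: x] into membership
    of [x]. *)
Lemma subset_of_ideal_mul_subset {G : groupType} {R : nzRingType}
    {M : lmodType R} {Rg : G -> set R} {Mg : G -> set M} {K N : set M}
    {P : set R} {a : R} :
  graded_submodule Mg K -> graded_r_submodule Rg Mg N ->
  P a -> homogeneous Rg a -> Ann M a = [set 0] ->
  ideal_mul P K `<=` ideal_mul P N -> K `<=` N.
Proof.
move=> gK [[subN _] _ rN] Pa ha Anna PKN.
apply: (graded_submodule_subset gK subN) => x Kx hx.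
apply: (rN a) => //; apply: (ideal_mul_subset (P := P) subN).
by apply: PKN; apply: sub_gen_smallest; exists a => //; exists x.
Qed.

Theorem theorem3p22 (G : groupType) (R : comNzRingType) (M : lmodType R)
    (Rg : G -> set R) (Mg : G -> set M)
    (gradedR : graded_ring Rg) (gradedM : graded_module Rg Mg)
    (M_neq0 : exists m : M, m != 0)
    (K N : set M)
    (rK : graded_r_submodule Rg Mg K) (rN : graded_r_submodule Rg Mg N)
    (P : set R) (gradedP : graded_ideal Rg P)
    (P_meets : P `&` (homogeneous Rg `\` zero_divisors M Rg) !=set0) :
  ideal_mul P K = ideal_mul P N -> K = N.
Proof.
move=> PKN; have [a [Pa [ha aNZ]]] := P_meets.
have Anna : Ann M a = [set 0] by apply: contrapT => Annn0; apply: aNZ.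
have [[gK _ _] [gN _ _]] := (rK, rN).
apply/seteqP; split.
- by apply: (subset_of_ideal_mul_subset gK rN Pa ha Anna); rewrite PKN.
- by apply: (subset_of_ideal_mul_subset gN rK Pa ha Anna); rewrite PKN.
Qed.
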